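(* Let $r,k$ be non-negative integers and $x$ an indeterminate. The bilinear product on the $\mathbb{C}(x)$-vector space $\mathrm{MP}_{r,k}(x)$ with basis $\{X_\pi : \pi\in\Pi_{r,k}\}$ determined by $$X_\pi\cdot X_\gamma=\sum_{\nu} a_\nu\, b_\nu(x)\, X_{\nu|_{[k]\cup[\bar{\bar k}]}}\qquad(\pi,\gamma\in\Pi_{r,k}),$$ where the sum is over all multiset partitions $\nu\in\Gamma_{r,k}$ such that $\nu|_{[k]\cup[\bar k]}=\pi$ and $\nu|_{[\bar k]\cup[\bar{\bar k}]}=\bar\gamma$, is associative.
   Context: Let $[k]=\{1,\dots,k\}$, $[\bar k]=\{\bar1,\dots,\bar k\}$, $[\bar{\bar k}]=\{\bar{\bar1},\dots,\bar{\bar k}\}$ be three disjoint alphabets. A multiset partition of a multiset $S$ is a multiset of non-empty multisets (its blocks) whose multiset union is $S$. Its length $\ell(\pi)$ is the number of blocks counted with multiplicity; $m(\pi)!$ is the product, over the distinct blocks $T$ of $\pi$, of $m_T(\pi)!$, where $m_T(\pi)$ is the multiplicity of $T$ in $\pi$. $\Pi_{r,k}$ is the set of all multiset partitions of multisets consisting of $r$ elements from $[k]$ and $r$ elements from $[\bar k]$ (counted with multiplicity). $\Gamma_{r,k}$ is the set of all multiset partitions of multisets consisting of $r$ elements from each of $[k]$, $[\bar k]$, $[\bar{\bar k}]$. For a set $A$, $\nu|_A$ is the (possibly empty) multiset partition obtained by restricting each block of $\nu$ to its elements in $A$ and discarding the empty results. For $\gamma\in\Pi_{r,k}$, $\bar\gamma$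 is obtained by adding one bar to every entry, so $\bar\gamma$ has entries in $[\bar k]\cup[\bar{\bar k}]$. For $\nu\in\Gamma_{r,k}$, the multiset partition $\nu|_{[k]\cup[\bar{\bar k}]}$ is regarded as an element of $\Pi_{r,k}$ by removing one bar from each doubly barred entry. For $\nu\in\Gamma_{r,k}$ and each distinct block $S$ of $\nu|_{[k]\cup[\bar{\bar k}]}$, let $\nu_S$ be the multiset of blocks $T$ of $\nu$ (with multiplicity) with $T|_{[k]\cup[\bar{\bar k}]}=S$. Let $\beta$ be the (possibly empty) multiset of the blocks of $\nu$ all of whose elements lie in $[\bar k]$. Define $$a_\nu=\prod_S\frac{\ell(\nu_S)!}{m(\nu_S)!},\qquad b_\nu(x)=\frac{(x-\ell(\nu|_{[k]\cup[\bar{\bar k}]}))_{\ell(\beta)}}{m(\beta)!},$$ where the product is over the distinct blocks $S$ of $\nu|_{[k]\cup[\bar{\bar k}]}$ and $(a)_s=a(a-1)\cdots(a-s+1)$. An empty sum is $0$. *)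

(* Defs.v *)
From HB Require Import structures.
From mathcomp Require Import all_boot all_order all_algebra.
From mathcomp Require Import finmap multiset.
From mathcomp Require Import complex reals.

Set Implicit Arguments.
Unset Strict Implicit.
Unset Printing Implicit Defensive.

Import GRing.Theory.
Local Open Scope mset_scope.
Local Open Scope ring_scope.

(* The pair (j, i) stands for the letter i carrying j bars.  Letters are
   indexed from 0, so that 'I_k plays the role of [k]. *)
Notation letter k := (nat * 'I_k)%type.

Section MultisetOps.
Context {K L : choiceType}.

Definition mset_filter (P : pred K) (A : {mset K}) : {mset K} :=
  seq_mset [seq a <- A | P a].

Definition mset_map (f : K -> L) (A : {mset K}) : {mset L} :=
  seq_mset [seq f a | a <- A].

Definition mset_union (pi : {mset {mset K}}) : {mset K} :=
  \big[msetD/mset0]_(T <- pi) T.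

Lemma count_seq_mset (P : pred K) (s : seq K) :
  count P (seq_mset s) = count P s.
Proof. exact/permP/perm_eq_seq_mset. Qed.

Lemma size_seq_mset (s : seq K) : size (seq_mset s) = size s.
Proof. exact/perm_size/perm_eq_seq_mset. Qed.

Lemma mem_seq_mset (s : seq K) : seq_mset s =i s.
Proof. exact/perm_mem/perm_eq_seq_mset. Qed.

Lemma count_msetD (P : pred K) (A B : {mset K}) :
  count P (A `+` B) = (count P A + count P B)%N.
Proof.
rewrite -count_cat -(count_seq_mset P (A ++ B)); congr (count P _).
by congr enum_mset; apply/msetP => a;
  rewrite mset_seqE count_cat !count_mem_mset msetE2.
Qed.

Lemma count_mset_union (P : pred K) (pi : {mset {mset K}}) :
  count P (mset_union pi) = (\sum_(T <- pi) count P (T : {mset K}))%N.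
Proof.
rewrite /mset_union; elim: (pi : seq _) => [|T s IH].
  by rewrite !big_nil enum_mset0.
by rewrite !big_cons count_msetD IH.
Qed.

End MultisetOps.

Section MultisetPartitions.
Variable k : nat.
Implicit Types (pi nu : {mset {mset letter k}}).

(* [pi] is a multiset partition (of [mset_union pi]) and [mset_union pi]
   consists of exactly r letters with j bars for each j < n. *)
Definition is_mpart (n r : nat) pi : bool :=
  [&& mset0 \notin pi,
      all (fun a : letter k => (a.1 < n)%N) (mset_union pi) &
      [forall j : 'I_n,
        count (fun a : letter k => a.1 == j :> nat) (mset_union pi) == r]].

Definition mp_restrict (A : pred (letter k)) pi : {mset {mset letter k}} :=
  mset_filter (fun T => T != mset0) (mset_map (mset_filter A) pi).

Definition mp_relabel (f : letter k -> letter k) pi : {mset {mset letter k}} :=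
  mset_map (mset_map f) pi.

Definition add_bar (a : letter k) : letter k := (a.1.+1, a.2).

Definition unbar2 (a : letter k) : letter k :=
  (if a.1 == 2%N then 1%N else a.1, a.2).

(* With bar counts 0, 1, 2 for the three alphabets: the restrictions to
   alphabets 0 and 1, 1 and 2, 0 and 2. *)
Definition restr01 nu := mp_restrict (fun a => a.1 \in [:: 0; 1]%N) nu.
Definition restr12 nu := mp_restrict (fun a => a.1 \in [:: 1; 2]%N) nu.
Definition in02 (a : letter k) : bool := a.1 \in [:: 0; 2]%N.
Definition restr02 nu := mp_restrict in02 nu.

(* For nu with bar counts 0, 1, 2: mp_above nu S is the multiset nu_S of blocks
   lying over the block S of restr02 nu, and mp_middle nu is the multiset beta of
   blocks contained in the alphabet with one bar. *)
Definition mp_above nu (S : {mset letter k}) : {mset {mset letter k}} :=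
  mset_filter (fun T => mset_filter in02 T == S) nu.

Definition mp_middle nu : {mset {mset letter k}} :=
  mset_filter (fun T : {mset letter k} =>
                 all (fun a : letter k => a.1 == 1%N) T) nu.

(* m(pi)!; [finsupp pi] is the set of distinct blocks of pi. *)
Definition mp_fact pi : nat := (\prod_(T <- finsupp pi) (pi T)`!)%N.

Record mpart (n r : nat) := MPart {
  mpart_val :> {mset {mset letter k}};
  mpartP : is_mpart n r mpart_val }.

HB.instance Definition _ n r := [isSub for @mpart_val n r].
HB.instance Definition _ n r := [Choice of mpart n r by <:].

(* Finiteness of [mpart n r]: it embeds in the bounded sequences of bounded
   sequences of letters. *)
Section Finiteness.
Variables n r : nat.
Let N := (n * r)%N.

Lemma is_mpart_size pi : is_mpart n r pi -> size (mset_union pi) = N.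
Proof.
case/and3P => _ /allP lt_n /forallP cnt.
have -> : size (mset_union pi) =
  (\sum_(a <- mset_union pi) \sum_(j < n) (a.1 == j :> nat))%N.
  rewrite -sum1_size big_seq [RHS]big_seq; apply: eq_bigr => a /lt_n an.
  rewrite (bigD1 (Ordinal an)) //= eqxx big1 ?addn0 // => j.
  by rewrite -val_eqE eq_sym /= => /negbTE->.
rewrite exchange_big /= /N -[n in (n * r)%N]card_ord -sum_nat_const.
apply: eq_bigr => j _; rewrite -(eqP (cnt j)) -sum1_count [RHS]big_mkcond /=.
by apply: eq_bigr => a _; case: eqP.
Qed.

Lemma sum_size_block pi :
  is_mpart n r pi -> (\sum_(T <- pi) size (T : {mset letter k}))%N = N.
Proof.
move=> /is_mpart_size <-; rewrite -count_predT count_mset_union.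
by apply: eq_bigr => T _; rewrite count_predT.
Qed.

Let code := N.-bseq (N.-bseq ('I_n.+1 * 'I_k)).

Let enc_letter (a : letter k) : 'I_n.+1 * 'I_k := (inord a.1, a.2).
Let dec_letter (a : 'I_n.+1 * 'I_k) : letter k := (val a.1, a.2).

Let enc (p : mpart n r) : code :=
  insub_bseq N [seq insub_bseq N [seq enc_letter a | a <- T]
               | T : {mset letter k} <- p].

Let dec (c : code) : option (mpart n r) :=
  insub (seq_mset [seq seq_mset [seq dec_letter a | a <- t]
                   | t : N.-bseq ('I_n.+1 * 'I_k) <- c]).

Let insub_bseqK (T : Type) (s : seq T) :
  (size s <= N)%N -> insub_bseq N s = s :> seq T.
Proof. by move=> sN; rewrite /insub_bseq insubdK. Qed.

Let encK : pcancel enc dec.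
Proof.
move=> p; have pP := mpartP p; have sumN := sum_size_block pP.
have blk (T : {mset letter k}) : T \in mpart_val p -> (size T <= N)%N.
  by move=> Tp; rewrite -sumN (big_rem T Tp) /= leq_addr.
have szp : (size p <= N)%N.
  rewrite -sumN -sum1_size [X in (X <= _)%N]big_seq [X in (_ <= X)%N]big_seq.
  apply: leq_sum => T Tp; rewrite lt0n size_mset_eq0.
  by case/and3P: pP => p0 _ _; apply: contraNneq p0 => <-.
rewrite /dec /enc insub_bseqK ?size_map // -map_comp.
rewrite (_ : seq_mset _ = mpart_val p) ?valK //.
rewrite -[RHS]seq_mset_id -[in RHS](map_id p).
congr seq_mset; apply/eq_in_map => /= T Tp; change {mset letter k} in T.
rewrite insub_bseqK ?size_map ?blk // -map_comp -[RHS]seq_mset_id.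
rewrite -[in RHS](map_id (enum_mset T)); congr seq_mset; apply/eq_in_map => a aT /=.
rewrite /dec_letter /enc_letter /= inordK; first by case: a aT.
case/and3P: pP => _ /allP lt_n _; apply/leqW/lt_n.
rewrite -has_pred1 has_count count_mset_union (big_rem T Tp) /=.
by rewrite ltn_addr // -has_count has_pred1.
Qed.

HB.instance Definition _ : isCountable (mpart n r) := PCanIsCountable encK.
HB.instance Definition _ : isFinite (mpart n r) := PCanIsFinite encK.

End Finiteness.

Lemma is_mpart_restr02 r nu :
  is_mpart 3 r nu -> is_mpart 2 r (mp_relabel unbar2 (restr02 nu)).
Proof.
move=> /and3P[_ /allP lt3 /forallP cnt].
have key P : count P (mset_union (mp_relabel unbar2 (restr02 nu))) =
    count (fun a => P (unbar2 a) && in02 a) (mset_union nu).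
  rewrite !count_mset_union.
  rewrite (perm_big _ (perm_eq_seq_mset _)) big_map /=.
  rewrite (perm_big _ (perm_eq_seq_mset _)) big_filter /=.
  rewrite (perm_big _ (perm_eq_seq_mset _)) big_map /=.
  rewrite big_mkcond /=; apply: eq_bigr => T _.
  have -> : count P (mset_map unbar2 (mset_filter in02 T)) =
            count (fun a => P (unbar2 a) && in02 a) (enum_mset T).
    by rewrite count_seq_mset count_map count_seq_mset count_filter.
  case: eqP => //= T0; apply/esym.
  have : size (mset_filter in02 T) = 0%N by rewrite T0 size_mset0.
  rewrite size_seq_mset size_filter => c0; apply/eqP.
  by rewrite -leqn0 -c0; apply: sub_count => a /= /andP[].
apply/and3P; split.
- rewrite mem_seq_mset; apply/mapP => -[T].
  rewrite mem_seq_mset mem_filter => /andP[T0 _] /(congr1 (fun A => size (enum_mset A))).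
  by rewrite size_mset0 size_seq_mset size_map => /esym/eqP; rewrite size_mset_eq0 (negbTE T0).
- rewrite all_count key -[X in _ == X]count_predT key; apply/eqP/eq_in_count => a /lt3.
  by case: a => [[|[|[|?]]] ?].
- apply/forallP => j; rewrite key.
  have l3 : ((if val j == 0 then 0 else 2) < 3)%N by case: (val j == 0%N).
  rewrite -(eqP (cnt (Ordinal l3))); apply/eqP/eq_in_count => a /lt3.
  by case: a j l3 => [[|[|[|?]]] ?] [[|[|?]] ?] ?.
Qed.

End MultisetPartitions.

Notation Pi r k := (mpart k 2 r).
Notation Gamma r k := (mpart k 3 r).

(* nu restricted to alphabets 0 and 2, regarded as an element of Pi r k. *)
Definition outer (r k : nat) (nu : Gamma r k) : Pi r k :=
  MPart (is_mpart_restr02 (mpartP nu)).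

(* C(x), the complex numbers being R[i] for a type R of real numbers. *)
Notation ratfun R := {fraction {poly R[i]}}.

(* The vector space over C(x) with basis indexed by the finite type Pi r k. *)
Notation MP R r k := {ffun Pi r k -> (ratfun R)^o}.

Section Algebra.
Variable R : realType.
Local Notation F := (ratfun R).
Local Notation x := (tofrac ('X : {poly R[i]})).

Definition falling (a : F) (s : nat) : F := \prod_(i < s) (a - i%:R).

Section Coefficients.
Variable k : nat.
Implicit Types nu : {mset {mset letter k}}.

Definition mp_a nu : F :=
  \prod_(S <- finsupp (restr02 nu))
     ((size (mp_above nu S))`!%:R / (mp_fact (mp_above nu S))%:R).

Definition mp_b nu : F :=
  falling (x - (size (restr02 nu))%:R) (size (mp_middle nu))
  / (mp_fact (mp_middle nu))%:R.

End Coefficients.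

Section Product.
Variables r k : nat.

Local Notation MP := (MP R r k).

Definition mp_X (pi : Pi r k) : MP := [ffun g => (g == pi)%:R].

Definition mp_mulX (pi gamma : Pi r k) : MP :=
  \sum_(nu : Gamma r k | (restr01 nu == mpart_val pi) &&
                         (restr12 nu == mp_relabel (@add_bar k) gamma))
     (mp_a nu * mp_b nu) *: mp_X (outer nu).

Definition mp_mul (u v : MP) : MP :=
  \sum_(pi : Pi r k) \sum_(gamma : Pi r k)
     (u pi * v gamma) *: mp_mulX pi gamma.

Lemma mp_mul_is_bilinear :
  bilinear_for ( *:%R : F -> MP -> MP) ( *:%R : F -> MP -> MP) mp_mul.
Proof.
split=> [v c u u'|u c v v']; rewrite /= /mp_mul scaler_sumr -big_split /=;
  apply: eq_bigr => p _; rewrite scaler_sumr -big_split /=;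
  apply: eq_bigr => g _; rewrite !ffunE scalerA -scalerDl; congr (_ *: _).
- by rewrite mulrDl mulrA.
- by rewrite mulrDr mulrCA.
Qed.

HB.instance Definition _ :=
  bilinear_isBilinear.Build F MP MP MP *:%R *:%R mp_mul mp_mul_is_bilinear.

Lemma mp_mulXX (pi gamma : Pi r k) :
  mp_mul (mp_X pi) (mp_X gamma) = mp_mulX pi gamma.
Proof.
rewrite /mp_mul (bigD1 pi) //= [X in _ + X]big1 => [|p /negbTE pN]; last first.
  by apply: big1 => g _; rewrite ffunE pN mul0r scale0r.
rewrite addr0 (bigD1 gamma) //= big1 => [|g /negbTE gN].
  by rewrite addr0 !ffunE !eqxx mulr1 scale1r.
by rewrite [mp_X gamma g]ffunE gN mulr0 scale0r.
Qed.

End Product.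
End Algebra.

(* Main.v *)
Require Import Defs.
From mathcomp Require Import all_boot all_algebra reals.
From mathcomp Require Import finmap multiset complex fraction.

(** The structure constants are polynomials in x, so associativity may be checked
    at x = n for all large integers n.  Consider words f of length n whose letters
    are multisets over [k], of total size r.  A pair of words (f, h) has a type in
    Pi_{r,k}, the multiset of the nonempty blocks f_i + bar h_i, and a triple
    (f, g, h) has a type in Gamma_{r,k}.  If (f, h) has type mu, the number of g
    such that (f, g, h) has type nu is a_nu b_nu(n): the words g are chosen
    independently on each set of positions i with a given block of (f, h), and the
    factor b_nu(n) comes from the positions where f and h are both empty.  Hence at
    x = n the coefficient of X_mu in X_pi X_gamma counts the g such that (f, g) has
    type pi and (g, h) has type gamma, and both bracketings of X_pi X_gamma X_delta
    count the same pairs (g, g'). *)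

Set Implicit Arguments.
Unset Strict Implicit.
Unset Printing Implicit Defensive.
Import GRing.Theory Num.Theory.
Local Open Scope mset_scope.

(** * Counting words with prescribed pair frequencies *)

Section ZipCount.
Variables K V : finType.

Lemma big_tuple_cons n (F : seq V -> nat) :
  \sum_(g : n.+1.-tuple V) F g = \sum_v \sum_(g : n.-tuple V) F (v :: g).
Proof.
rewrite pair_big /= (reindex (fun p : V * n.-tuple V => cons_tuple p.1 p.2)) //=.
exists (fun t : n.+1.-tuple V => (thead t, behead_tuple t)).
  by case=> v g _ /=; congr (_, _); apply: val_inj.
by move=> t _ /=; rewrite [RHS]tuple_eta; apply: val_inj.
Qed.

Lemma prod_fact_incr (T : finType) (N : T -> nat) (t : T) :
  \prod_p (N p + (t == p))`! = (N t).+1 * \prod_p (N p)`!.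
Proof.
rewrite (bigD1 t) //= [in RHS](bigD1 t) //= eqxx addn1 factS mulnA; congr (_ * _).
by apply: eq_bigr => p; rewrite eq_sym => /negbTE->; rewrite addn0.
Qed.

(** The words [g] are counted by a product of multinomial coefficients, one for each letter of [q],
    here cleared of denominators. In the induction on [q], a first letter [v] of [g] uses up one
    pair [(a, v)], which takes a factor [N (a, v)] out of the factorials; over all [v] these factors
    add up to the new multiplicity of [a]. *)
Lemma sum_zip_count (q : seq K) (N : K * V -> nat) :
  (forall a, \sum_v N (a, v) = count_mem a q) ->
  (\sum_(g : (size q).-tuple V) [forall p, count_mem p (zip q g) == N p])
    * \prod_p (N p)`! = \prod_a (count_mem a q)`!.
Proof.
elim: q N => [|a q IH] N HN /=.
  have N0 p : N p = 0.
    case: p => a v; have /eqP := HN a; rewrite /= sum_nat_eq0 => /forallP/(_ v).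
    by move/eqP.
  rewrite (eq_bigr (fun => 1)) => [|g _]; last first.
    by rewrite (tuple0 g) /=; apply/eqP; rewrite eqb1; apply/forallP => p; rewrite N0.
  rewrite sum1_card card_tuple expn0 mul1n !big1 // => p _.
  by rewrite N0.
rewrite (eq_bigr (fun b => (count_mem b q + (a == b))`!)) => [|b _]; last first.
  by rewrite addnC.
rewrite prod_fact_incr.
rewrite (big_tuple_cons (size q) (fun g => ([forall p, count_mem p (zip (a :: q) g) == N p]))).
rewrite big_distrl /=.
have -> : (count_mem a q).+1 = \sum_v N (a, v) by rewrite HN /= eqxx.
rewrite [RHS]big_distrl /=; apply: eq_bigr => v _.
case: (posnP (N (a, v))) => [N0|Npos].
  rewrite N0 mul0n big1 ?mul0n // => g _; apply/eqP; rewrite eqb0.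
  by apply/negP => /forallP/(_ (a, v)) /=; rewrite N0 eqxx.
(* The frequencies left for the tail once [(a, v)] is used. The truncated subtraction is exact
   because [N (a, v)] is positive. *)
pose N' p := N p - ((a, v) == p).
have NE p : N p = N' p + ((a, v) == p).
  by rewrite /N' subnK //; case: eqP => // <-.
have /IH {IH} IH : forall b, \sum_w N' (b, w) = count_mem b q.
  move=> b; have := HN b; rewrite /= (eq_bigr _ (fun w _ => NE (b, w))) big_split /=.
  rewrite (_ : \sum_w ((a, v) == (b, w)) = (a == b)); last first.
    rewrite (bigD1 v) //= xpair_eqE eqxx andbT big1 ?addn0 // => w.
    by rewrite xpair_eqE eq_sym => /negbTE->; rewrite andbF.
  by rewrite addnC => /addnI.
rewrite [X in _ * X](eq_bigr _ (fun p _ => congr1 _ (NE p))) prod_fact_incr.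
rewrite (_ : (N' (a, v)).+1 = N (a, v)); last by rewrite NE eqxx addn1.
rewrite -IH mulnCA; congr (_ * (_ * _)); apply: eq_bigr => g _; congr nat_of_bool.
by apply: eq_forallb => p; rewrite NE addnC eqn_add2r.
Qed.

Lemma sum_zip_perm n (q : seq K) (L : seq (K * V)) :
  size q = n -> perm_eq (unzip1 L) q ->
  (\sum_(g : n.-tuple V) perm_eq (zip q g) L) * \prod_p (count_mem p L)`!
    = \prod_a (count_mem a q)`!.
Proof.
move=> <- /permP Lq; rewrite -(@sum_zip_count q (fun p => count_mem p L)).
  congr (_ * _); apply: eq_bigr => g _; congr nat_of_bool.
  apply/idP/forallP => [/permP H p|H]; first exact/eqP/H.
  by apply/allP => p _; exact: H.
move=> a; rewrite -Lq count_map -sum1_count.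
rewrite (eq_bigr (fun v => \sum_(p <- L) (p == (a, v)))) => [|v _]; last first.
  by rewrite -sum1_count big_mkcond /=; apply: eq_bigr => p _; case: eqP.
rewrite exchange_big /= [RHS]big_mkcond /=; apply: eq_bigr => -[a' v] _ /=.
rewrite (bigD1 v) //= xpair_eqE eqxx andbT big1 ?addn0; first by case: eqP.
by move=> w; rewrite xpair_eqE eq_sym => /negbTE->; rewrite andbF.
Qed.
End ZipCount.

(** * Multisets of blocks *)

Section MsetOps.
Variables K L : choiceType.

Lemma mset_map_seq (f : K -> L) s : mset_map f (seq_mset s) = seq_mset (map f s).
Proof. by apply/eq_seq_msetP/perm_map/perm_eq_seq_mset. Qed.

Lemma mset_filter_seq (P : pred K) s :
  mset_filter P (seq_mset s) = seq_mset (filter P s).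
Proof. by apply/eq_seq_msetP/perm_filter/perm_eq_seq_mset. Qed.

Lemma mset_mapE (f : K -> L) A y : mset_map f A y = count (fun x => f x == y) A.
Proof. by rewrite mset_seqE count_map. Qed.

Lemma mset_filterE (P : pred K) (A : {mset K}) x :
  mset_filter P A x = if P x then A x else 0.
Proof.
rewrite mset_seqE count_filter -count_mem_mset; case: ifP => Px.
  by apply: eq_count => y /=; case: eqP => //= ->.
by apply/eqP; rewrite -leqn0 -(count_pred0 A); apply/eq_leq/eq_count => y /=;
  case: eqP => //= ->.
Qed.

Lemma mset_filter0 (P : pred K) : mset_filter P mset0 = mset0.
Proof. by apply/msetP => x; rewrite mset_filterE mset0E; case: ifP. Qed.

Lemma mset_map_eq0 (f : K -> L) A : (mset_map f A == mset0) = (A == mset0).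
Proof. by rewrite -!size_mset_eq0 size_seq_mset size_map. Qed.

Lemma mset_map_inj (f : K -> L) : injective f -> injective (mset_map f).
Proof.
move=> fI A B /eq_seq_msetP /(perm_map_inj fI) AB.
by rewrite -(seq_mset_id A) -(seq_mset_id B); apply/eq_seq_msetP.
Qed.

End MsetOps.

Section Strip.
Variable C : choiceType.
Local Notation B := {mset C}.

(** Passes from the list of blocks at the positions of a word, some of them empty, to a multiset
    partition. *)
Definition strip (s : seq B) : {mset B} := seq_mset [seq T <- s | T != mset0].

Lemma strip_id (p : {mset B}) : mset0 \notin p -> strip p = p.
Proof.
move=> p0; rewrite /strip -[RHS]seq_mset_id; congr seq_mset; apply/all_filterP.
by apply/allP => T Tp; apply: contraNneq p0 => <-.
Qed.

Lemma mset0_strip s : mset0 \notin strip s.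
Proof. by rewrite mem_seq_mset mem_filter eqxx. Qed.

Lemma strip_cat_nseq s m : strip (s ++ nseq m mset0) = strip s.
Proof.
by rewrite /strip filter_cat; elim: m => [|m IH] /=; rewrite ?cats0 ?eqxx.
Qed.

(** The common length determines the number of discarded empty blocks, so stripping forgets only the
    order. *)
Lemma perm_strip s t : size s = size t -> (strip s == strip t) = perm_eq s t.
Proof.
move=> st; apply/eqP/idP => [/eq_seq_msetP st'|st']; last first.
  exact/eq_seq_msetP/perm_filter.
rewrite -(perm_filterC (fun T : B => T != mset0) s) perm_sym.
rewrite -(perm_filterC (fun T : B => T != mset0) t) perm_sym perm_cat //.
have zeros (u : seq B) : [seq T <- u | ~~ (T != mset0)] =
    nseq (size u - size [seq T <- u | T != mset0]) mset0.
  rewrite -(count_predC (fun T : B => T != mset0) u) size_filter addKn -size_filter.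
  apply/all_pred1P/allP => T; rewrite mem_filter negbK => /andP[/eqP-> _] /=.
  exact: eqxx.
by rewrite !zeros st (perm_size st').
Qed.

Lemma strip_filter (P : pred B) s : mset_filter P (strip s) = strip (filter P s).
Proof.
rewrite /strip mset_filter_seq; congr seq_mset; rewrite -!filter_predI.
by apply: eq_filter => T /=; rewrite andbC.
Qed.

Lemma strip_map (f : B -> B) s : (forall T, T == mset0 -> f T == mset0) ->
  strip (map f [seq T <- s | T != mset0]) = strip (map f s).
Proof.
move=> f0; rewrite /strip !filter_map -filter_predI; congr (seq_mset (map _ _)).
by apply: eq_filter => T /=; case: (boolP (T == _)) => [/f0/eqP->|]; rewrite ?eqxx ?andbT.
Qed.

Lemma size_strip s : size (strip s) = count (fun T => T != mset0) s.
Proof. by rewrite size_seq_mset size_filter. Qed.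

Lemma count_union_strip (P : pred C) s :
  count P (mset_union (strip s)) = \sum_(T <- s) count P (T : B).
Proof.
rewrite count_mset_union (perm_big _ (perm_eq_seq_mset _)) big_filter big_mkcond /=.
by apply: eq_bigr => T _; case: eqP => //= ->; rewrite enum_mset0.
Qed.

Variables (K : finType) (b : K -> B).
Hypothesis bI : injective b.

Lemma strip_mapE s p : b p != mset0 -> strip (map b s) (b p) = count_mem p s.
Proof.
move=> p0; rewrite mset_seqE count_filter count_map; apply: eq_count => q /=.
by rewrite inj_eq //; case: eqP => //= ->.
Qed.

(** Turns products over the distinct blocks of a partition into products over the finite type of
    codes; codes that do not occur must contribute the unit. *)
Lemma big_strip R (idx : R) (op : Monoid.com_law idx) s (G : B -> R) :
  (forall p, p \notin s -> G (b p) = idx) ->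
  \big[op/idx]_(T <- finsupp (strip (map b s))) G T
    = \big[op/idx]_(p | b p != mset0) G (b p).
Proof.
move=> G1; rewrite (bigID (mem s)) /= [X in op _ X]big1 ?Monoid.mulm1; last first.
  by move=> p /andP[_ /G1].
rewrite -(big_filter _ (fun p => (b p != mset0) && (p \in s))) -(big_map b predT G).
apply: perm_big; apply: uniq_perm; rewrite ?fset_uniq //.
  by rewrite map_inj_uniq // filter_uniq // index_enum_uniq.
move=> T; rewrite msuppE mem_seq_mset mem_filter; apply/andP/mapP.
  case=> T0 /mapP[p ps defT]; rewrite defT in T0 *.
  by exists p; rewrite // mem_filter T0 ps mem_index_enum.
case=> p; rewrite mem_filter => /andP[/andP[p0 ps] _] ->; split=> //.
exact: map_f.
Qed.

End Strip.

Section MpartStrip.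
Variable k : nat.
Local Notation B := {mset letter k}.

Lemma mp_restrict_strip A (s : seq B) :
  mp_restrict A (strip s) = strip (map (mset_filter A) s).
Proof.
rewrite /mp_restrict {1}/strip mset_map_seq mset_filter_seq.
by apply: strip_map => T /eqP->; rewrite mset_filter0.
Qed.

Lemma mp_relabel_strip f (s : seq B) :
  mp_relabel f (strip s) = strip (map (mset_map f) s).
Proof.
rewrite /mp_relabel {1}/strip mset_map_seq /strip filter_map.
by congr seq_mset; congr map; apply: eq_filter => T /=; rewrite mset_map_eq0.
Qed.

Lemma mp_fact_strip (K : finType) (b : K -> B) s : injective b ->
  mp_fact (strip (map b s)) = \prod_(p | b p != mset0) (count_mem p s)`!.
Proof.
move=> bI; rewrite /mp_fact (big_strip bI) => [|p pNs].
  by apply: eq_bigr => p p0; rewrite strip_mapE.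
have [/eqP-> |p0] := boolP (b p == mset0).
  by rewrite (mset_eq0P (mset0_strip _)).
by rewrite strip_mapE // (count_memPn pNs).
Qed.

End MpartStrip.

(** * Blocks as tuples of multiplicity vectors *)

Section Blocks.
Variables k r : nat.
Local Notation B := {mset letter k}.
Local Notation V := {ffun 'I_k -> 'I_r.+1}.

Definition zeroV : V := [ffun=> ord0].

(* Multiplicities in a partition from Pi_{r,k} or Gamma_{r,k} are at most r; this
   bound makes the letters of words a finite type. *)
Definition blk (s : seq V) : B :=
  [fsfun a in [fset (val p.1, p.2) | p in [set: 'I_(size s) * 'I_k]]%fset
     => val (nth zeroV s a.1 a.2)].

Lemma blkE s (a : letter k) : blk s a = nth zeroV s a.1 a.2.
Proof.
rewrite fsfunE; case: ifP => //; case: a => j i /=.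
have [js|sj] := ltnP j (size s); last by rewrite nth_default // ffunE.
by move=> /imfsetP[]; exists (Ordinal js, i); rewrite //= !inE.
Qed.

Definition blk01 (p : V * V) : B := blk [:: p.1; p.2].
Definition blk12 (p : V * V) : B := blk [:: zeroV; p.1; p.2].
Definition blk02 (p : V * V) : B := blk [:: p.1; zeroV; p.2].
(** The vector of the middle alphabet comes last in the code: restriction to the two outer alphabets
    is then the first projection, and the unknown word [g] is the second component of a [zip]. *)
Definition blk3 (p : (V * V) * V) : B := blk [:: p.1.1; p.2; p.1.2].

Lemma blk_inj s t : size s = size t -> blk s = blk t -> s = t.
Proof.
move=> st /msetP E; apply: (@eq_from_nth _ zeroV) => // j _.
by apply/ffunP => i; apply: val_inj; have := E (j, i); rewrite !blkE.
Qed.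

Lemma blk01_inj : injective blk01.
Proof. by case=> u v [u' v'] /(@blk_inj [:: u; v] [:: u'; v'] erefl)[-> ->]. Qed.

Lemma blk02_inj : injective blk02.
Proof.
by case=> u v [u' v'] /(@blk_inj [:: u; zeroV; v] [:: u'; zeroV; v'] erefl)[-> ->].
Qed.

Lemma blk3_inj : injective blk3.
Proof.
case=> -[u v] w [[u' v'] w'].
by move=> /(@blk_inj [:: u; w; v] [:: u'; w'; v'] erefl)[-> -> ->].
Qed.

Lemma blk_zero : blk [:: zeroV; zeroV; zeroV] = mset0.
Proof.
apply/msetP => -[j i]; rewrite blkE mset0E /=.
by case: j => [|[|[|j]]]; rewrite /= ?nth_nil ffunE.
Qed.

Lemma blk02_eq0 a : (blk02 a == mset0) = (a == (zeroV, zeroV)).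
Proof. by rewrite -blk_zero -[blk _]/(blk02 (zeroV, zeroV)) (inj_eq blk02_inj). Qed.

Lemma blk3_eq0 p : (blk3 p == mset0) = (p == (zeroV, zeroV, zeroV)).
Proof. by rewrite -blk_zero -[blk _]/(blk3 (zeroV, zeroV, zeroV)) (inj_eq blk3_inj). Qed.

Lemma blk01_zero : blk01 (zeroV, zeroV) = mset0.
Proof.
rewrite -blk_zero; apply/msetP => -[j i]; rewrite !blkE /=.
by case: j => [|[|[|j]]] //=; rewrite ?nth_nil.
Qed.

Lemma filter01_blk3 p :
  mset_filter (fun a : letter k => a.1 \in [:: 0; 1]) (blk3 p) = blk01 (p.1.1, p.2).
Proof.
apply/msetP => -[j i]; rewrite mset_filterE !blkE /= !inE.
by case: j => [|[|[|j]]] //=; rewrite ?nth_nil ?ffunE.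
Qed.

Lemma filter12_blk3 p :
  mset_filter (fun a : letter k => a.1 \in [:: 1; 2]) (blk3 p) = blk12 (p.2, p.1.2).
Proof.
apply/msetP => -[j i]; rewrite mset_filterE !blkE /= !inE.
by case: j => [|[|[|j]]] //=; rewrite ?nth_nil ?ffunE.
Qed.

Lemma filter02_blk3 p : mset_filter (@in02 k) (blk3 p) = blk02 p.1.
Proof.
apply/msetP => -[j i]; rewrite mset_filterE !blkE /= /in02 !inE.
by case: j => [|[|[|j]]] //=; rewrite ?nth_nil ?ffunE.
Qed.

Lemma add_bar_blk01 p : mset_map (@add_bar k) (blk01 p) = blk12 p.
Proof.
apply/msetP => -[[|j] i]; rewrite mset_mapE blkE /=.
  by rewrite ffunE; apply/eqP; rewrite -leqn0 leqNgt -has_count -all_predC; apply/allP.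
rewrite -[RHS]/(nat_of_ord (nth zeroV [:: p.1; p.2] (j, i).1 (j, i).2)) -blkE.
rewrite -count_mem_mset; apply: eq_count => -[j' i'] /=.
by rewrite !xpair_eqE eqSS.
Qed.

Lemma add_bar_inj : injective (@add_bar k).
Proof. by case=> j i [j' i'] [-> ->]. Qed.

Lemma unbar2_blk02 p : mset_map (@unbar2 k) (blk02 p) = blk01 p.
Proof.
apply/msetP => -[j i]; rewrite mset_mapE blkE.
(* [unbar2] is not injective, but [blk02 p] has no letter with one bar. On such blocks the letters
   sent to [(j, i)] are the copies of [(j', i)]; for [j = 2] there are none on either side. *)
pose j' := if j == 1 then 2 else if j == 2 then 1 else j.
transitivity (count_mem ((j', i) : letter k) (blk02 p)).
  apply: eq_in_count => -[m i']; rewrite in_mset blkE /unbar2 /j' /= !xpair_eqE.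
  by case: m => [|[|[|m]]]; case: j @j' => [|[|[|j]]]; rewrite //= ?ffunE // nth_nil ffunE.
rewrite count_mem_mset blkE /j' /=.
by case: j @j' => [|[|[|j]]] //=; rewrite ?nth_nil ?ffunE.
Qed.

Definition weight (v : V) : nat := \sum_i v i.
Definition total (f : seq V) := \sum_(v <- f) weight v.

Lemma count_bars_blk j s :
  count (fun a : letter k => a.1 == j) (blk s) = weight (nth zeroV s j).
Proof.
rewrite /weight -sum1_count big_mkcond /=.
rewrite (eq_bigr (fun a : letter k => \sum_i (a == (j, i)))) => [|[j' i] _]; last first.
  rewrite (bigD1 i) //= xpair_eqE eqxx andbT big1 ?addn0; first by case: eqP.
  by move=> i'; rewrite xpair_eqE eq_sym => /negbTE->; rewrite andbF.
rewrite exchange_big /=; apply: eq_bigr => i _.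
rewrite -[RHS]/(nat_of_ord (nth zeroV s (j, i).1 (j, i).2)) -blkE -count_mem_mset.
by rewrite -sum1_count [RHS]big_mkcond; apply: eq_bigr => a _ /=; case: eqP.
Qed.

(** Stripping removes empty blocks and lists of length [n] produce no letter with [n] or more bars,
    so only the [n] degree conditions remain. *)
Lemma is_mpart_strip n (ss : seq (seq V)) : all (fun s => size s == n) ss ->
  is_mpart n r (strip (map blk ss)) =
  [forall j : 'I_n, \sum_(s <- ss) weight (nth zeroV s j) == r].
Proof.
move=> /allP ssn; rewrite /is_mpart mset0_strip /=.
rewrite all_count -[X in _ == X]count_predT !count_union_strip !big_map.
rewrite (_ : _ == _) /=; last first.
  apply/eqP; rewrite big_seq [RHS]big_seq; apply: eq_bigr => s /ssn/eqP <-.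
  apply: eq_in_count => -[j i]; rewrite in_mset blkE /= => pos.
  by rewrite ltnNge; apply: contraTN pos => js; rewrite nth_default // ffunE.
apply: eq_forallb => j; rewrite count_union_strip big_map.
by congr (_ == _); apply: eq_bigr => s _; rewrite count_bars_blk.
Qed.

(** Each block is contained in the union of all blocks. The bound shows that multiplicities fit into
    ['I_r.+1], so that blocks can be decoded as lists of vectors. *)
Lemma mpart_letter n (p : mpart k n r) (T : B) (a : letter k) :
  T \in mpart_val p -> T a <= (a.1 < n) * r.
Proof.
move=> Tp; have cT P : count P T <= count P (mset_union p).
  by rewrite count_mset_union (big_rem T Tp) /= leq_addr.
case/and3P: (mpartP p) => _ lt_n /forallP cnt.
rewrite -count_mem_mset; have [an|na] := ltnP a.1 n.
  rewrite mul1n -(eqP (cnt (Ordinal an))); apply: leq_trans (cT _).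
  by apply: sub_count => b /= /eqP->.
apply: leq_trans (cT _) _; rewrite mul0n leqNgt -has_count -all_predC.
apply: sub_all lt_n => b /= bn; apply: contraTneq bn => ->.
by rewrite -leqNgt.
Qed.

Lemma mpart_decode n (p : mpart k n r) (T : B) : n <= 3 -> T \in mpart_val p ->
  exists2 s : seq V, size s = n & blk s = T.
Proof.
move=> n3 Tp.
exists (mkseq (fun j => [ffun i => inord (T (j, i))] : V) n); first by rewrite size_mkseq.
apply/msetP => -[j i]; rewrite blkE /=; have := mpart_letter (j, i) Tp.
have [jn|nj] := ltnP j n.
  by rewrite /= mul1n => Tr; rewrite nth_mkseq // ffunE inordK.
by rewrite mul0n leqn0 => /eqP->; rewrite nth_default ?size_mkseq // ffunE.
Qed.

End Blocks.

(** * Types of pairs and triples of words *)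

Section Words.
Variables k r : nat.
Local Notation B := {mset letter k}.
Local Notation V := {ffun 'I_k -> 'I_r.+1}.
Local Notation zeroV := (@zeroV k r).
Implicit Types (f g h : seq V) (L : seq ((V * V) * V)).

Definition pair_type f g : {mset B} := strip (map (@blk01 k r) (zip f g)).
Definition triple_type f g h : {mset B} := strip (map (@blk3 k r) (zip (zip f h) g)).

(** Restricting position by position to two alphabets forgets one of the three words. This and the
    next lemmas turn the conditions on [nu] in the product into conditions on pairs of words. *)
Lemma restr01_triple_type f g h : size g = size f -> size h = size f ->
  restr01 (triple_type f g h) = pair_type f g.
Proof.
move=> gf hf; rewrite /restr01 mp_restrict_strip -map_comp; congr strip.
elim: f g h gf hf => [|u f IH] [|v g] [|w h] //= [gf] [hf].
by rewrite filter01_blk3 IH.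
Qed.

Lemma restr12_triple_type f g h : size g = size f -> size h = size f ->
  restr12 (triple_type f g h) = mp_relabel (@add_bar k) (pair_type g h).
Proof.
move=> gf hf; rewrite /restr12 mp_restrict_strip mp_relabel_strip -!map_comp.
congr strip; elim: f g h gf hf => [|u f IH] [|v g] [|w h] //= [gf] [hf].
by rewrite filter12_blk3 add_bar_blk01 IH.
Qed.

Lemma restr02_blk3 L :
  restr02 (strip (map (@blk3 k r) L)) = strip (map (@blk02 k r) (unzip1 L)).
Proof.
rewrite /restr02 mp_restrict_strip -!map_comp; congr strip.
by apply: eq_map => p /=; rewrite filter02_blk3.
Qed.

Lemma unbar2_strip (q : seq (V * V)) :
  mp_relabel (@unbar2 k) (strip (map (@blk02 k r) q)) = strip (map (@blk01 k r) q).
Proof.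
rewrite mp_relabel_strip -map_comp; congr strip.
by apply: eq_map => p /=; rewrite unbar2_blk02.
Qed.

Lemma mp_above_blk3 L a :
  mp_above (strip (map (@blk3 k r) L)) (blk02 a)
    = strip (map (@blk3 k r) [seq p <- L | p.1 == a]).
Proof.
rewrite /mp_above strip_filter filter_map; congr (strip (map _ _)).
by apply: eq_filter => p /=; rewrite filter02_blk3 (inj_eq (@blk02_inj k r)).
Qed.

(** A block lies in the middle alphabet exactly when its outer pair is zero. The empty blocks also
    selected by this filter disappear under [strip]. *)
Lemma mp_middle_blk3 L :
  mp_middle (strip (map (@blk3 k r) L))
    = strip (map (@blk3 k r) [seq p <- L | p.1 == (zeroV, zeroV)]).
Proof.
rewrite /mp_middle strip_filter filter_map; congr (strip (map _ _)).
apply: eq_filter => p /=; rewrite -blk02_eq0 -filter02_blk3 -size_mset_eq0 size_seq_mset.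
rewrite size_filter -leqn0 leqNgt -has_count -all_predC; apply: eq_in_all => -[j i].
rewrite in_mset blkE /in02 /= !inE.
by case: j => [|[|[|j]]] //=; rewrite nth_nil ffunE.
Qed.

Lemma is_mpart_pair_type f g : size g = size f ->
  is_mpart 2 r (pair_type f g) = (total f == r) && (total g == r).
Proof.
move=> gf; rewrite /pair_type (eq_map (g := @blk k r \o (fun p => [:: p.1; p.2]))) // map_comp.
rewrite is_mpart_strip ?all_map; last by apply/allP.
have E1 : total f = \sum_(s <- [seq [:: p.1; p.2] | p <- zip f g]) weight (nth zeroV s 0).
  by rewrite big_map -(big_map fst predT) -/(unzip1 _) unzip1_zip ?gf.
have E2 : total g = \sum_(s <- [seq [:: p.1; p.2] | p <- zip f g]) weight (nth zeroV s 1).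
  by rewrite big_map -(big_map snd predT) -/(unzip2 _) unzip2_zip ?gf.
rewrite E1 E2; apply/forallP/andP => [H|[H0 H1] [[|[|j]] //]].
by split; [exact: (H (Ordinal (isT : 0 < 2))) | exact: (H (Ordinal (isT : 1 < 2)))].
Qed.

Lemma is_mpart_triple_type f g h : size g = size f -> size h = size f ->
  total f = r -> total g = r -> total h = r -> is_mpart 3 r (triple_type f g h).
Proof.
move=> gf hf tf tg th.
rewrite /triple_type (eq_map (g := @blk k r \o (fun p => [:: p.1.1; p.2; p.1.2]))) // map_comp.
rewrite is_mpart_strip ?all_map; last by apply/allP.
have s2 : size g = size (zip f h) by rewrite size1_zip ?hf.
apply/forallP => -[[|[|[|j]]] //= _]; rewrite big_map /=; apply/eqP.
- rewrite -(big_map (fun p => p.1.1) predT (@weight k r)) (map_comp fst fst).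
  by rewrite -!/(unzip1 _) !unzip1_zip ?s2 ?hf // -/(total f) tf.
- rewrite -(big_map (fun p => p.2) predT (@weight k r)).
  by rewrite -!/(unzip2 _) !unzip2_zip ?s2 ?hf // -/(total g) tg.
- rewrite -(big_map (fun p => p.1.2) predT (@weight k r)) (map_comp snd fst).
  by rewrite -!/(unzip1 _) -/(unzip2 _) unzip1_zip ?unzip2_zip ?s2 ?hf // -/(total h) th.
Qed.

(** Padding with the code [z] of the empty block reaches every length that is at least the number of
    blocks. *)
Lemma strip_code (K : Type) (b : K -> B) z (p : {mset B}) m : b z = mset0 ->
  mset0 \notin p -> (forall T : B, T \in p -> exists x, b x = T) -> size p <= m ->
  exists2 s, size s = m & strip (map b s) = p.
Proof.
move=> bz p0 dec pm.
have [s Es] : exists s, map b s = p.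
  have {dec} : forall T : B, T \in enum_mset p -> exists x, b x = T by [].
  elim: (enum_mset p) => [|T s IH] dec; first by exists [::].
  have [x xT] := dec T (mem_head T s).
  have [T' T's|t ts] := IH; first by apply: dec; rewrite inE T's orbT.
  by exists (x :: t); rewrite /= xT ts.
exists (s ++ nseq (m - size p) z).
  by rewrite size_cat size_nseq -Es size_map subnKC // -(size_map b) Es.
by rewrite map_cat map_nseq bz strip_cat_nseq Es strip_id.
Qed.

End Words.

(** * Structure constants as polynomials in x *)

Section Codes.
Variables k r n : nat.
Local Notation V := {ffun 'I_k -> 'I_r.+1}.

Lemma Gamma_code (nu : Gamma r k) : size (mpart_val nu) <= n ->
  exists2 L : seq ((V * V) * V), size L = n & strip (map (@blk3 k r) L) = nu.
Proof.
move=> sn; case/and3P: (mpartP nu) => nu0 _ _.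
apply: (strip_code (blk_zero k r : blk3 (zeroV k r, zeroV k r, zeroV k r) = _)) => //.
(* Decoding lists the vectors by number of bars, whereas [blk3] expects the outer pair first, hence
   [(u, w, v)]. *)
move=> T /mpart_decode[//|s]; case: s => [|u [|v [|w []]]] //= _ <-; by exists (u, w, v).
Qed.

(** Supplies the pair of words of type [mu] against which the coefficient of [X_mu] is read as a
    count. *)
Lemma Pi_words (mu : Pi r k) : size (mpart_val mu) <= n ->
  exists f h : n.-tuple V, pair_type f h = mu.
Proof.
move=> sn; case/and3P: (mpartP mu) => mu0 _ _.
have [T|q sq <-] := strip_code (blk01_zero k r) mu0 _ sn.
  by move=> /mpart_decode[//|s]; case: s => [|u [|v []]] //= _ <-; exists (u, v).
have s1 : size (unzip1 q) == n by rewrite size_map sq.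
have s2 : size (unzip2 q) == n by rewrite size_map sq.
by exists (Tuple s1), (Tuple s2); rewrite /pair_type /= zip_unzip.
Qed.
End Codes.

Local Open Scope ring_scope.

Section Poly.
Variables (R : realType) (k r : nat).
Local Notation C := R[i].
Local Notation V := {ffun 'I_k -> 'I_r.+1}.
Implicit Types nu : {mset {mset letter k}}.

(** The product of [a_nu] and [b_nu(x)]: all denominators are constants, so it is a polynomial and
    can be evaluated at integers. *)
Definition mp_coef nu : {poly C} :=
  ((\prod_(S <- finsupp (restr02 nu))
     ((size (mp_above nu S))`!%:R / (mp_fact (mp_above nu S))%:R))
   / (mp_fact (mp_middle nu))%:R)%:P *
  \prod_(i < size (mp_middle nu)) ('X - (size (restr02 nu) + i)%:R%:P).

Lemma tofrac_mp_coef nu : tofrac (mp_coef nu) = mp_a R nu * mp_b R nu.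
Proof.
pose phi : {rmorphism C -> {fraction {poly C}}} := (@tofrac _) \o polyC.
have phiE c : tofrac c%:P = phi c by [].
rewrite /mp_coef tofracM phiE fmorph_div rmorph_nat rmorph_prod.
rewrite /mp_a /mp_b -!mulrA; congr (_ * _).
  by apply: eq_bigr => S _; rewrite fmorph_div !rmorph_nat.
rewrite mulrC; congr (_ * _); rewrite rmorph_prod; apply: eq_bigr => i _ /=.
by rewrite tofracB phiE rmorph_nat natrD opprD addrA.
Qed.

(** For [s > m] both sides are zero, the left one through its factor with [i = m]. *)
Lemma prod_natr_ffact m s : \prod_(i < s) (m%:R - i%:R) = (m ^_ s)%:R :> C.
Proof.
elim: s => [|s IH]; first by rewrite big_ord0 ffactn0.
rewrite big_ord_recr /= IH ffactnSr natrM; have [sm|ms] := leqP s m.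
  by rewrite natrB.
by rewrite ffact_small // !mul0r.
Qed.

Lemma horner_mp_coef nu n : (size (restr02 nu) <= n)%N -> (mp_coef nu).[n%:R] =
  (\prod_(S <- finsupp (restr02 nu))
     ((size (mp_above nu S))`!%:R / (mp_fact (mp_above nu S))%:R)) *
  (((n - size (restr02 nu)) ^_ (size (mp_middle nu)))%N%:R
     / (mp_fact (mp_middle nu))%:R).
Proof.
move=> sn; rewrite hornerM hornerC horner_prod -mulrA; congr (_ * _).
rewrite mulrC -prod_natr_ffact; congr (_ * _); apply: eq_bigr => i _.
by rewrite hornerD hornerN hornerX hornerC natrB // natrD opprD addrA.
Qed.

Section Fibre.
Variable L : seq ((V * V) * V).
(** When [L] codes [nu], this is the multiset [nu_S] with [S = blk02 a] for a nonzero pair [a], and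
    it is [beta] for the zero pair. *)
Let fibre a := strip (map (@blk3 k r) [seq p <- L | p.1 == a]).
Local Notation zeroV := (zeroV k r).

Lemma size_fibre a :
  size (fibre a) = count (fun p => (p.1 == a) && (p != (zeroV, zeroV, zeroV))) L.
Proof.
rewrite size_strip count_map count_filter; apply: eq_count => p /=.
by rewrite blk3_eq0 andbC.
Qed.

Lemma mp_fact_fibre a :
  mp_fact (fibre a) = (\prod_(v | (a, v) != (zeroV, zeroV, zeroV)) (count_mem (a, v) L)`!)%N.
Proof.
rewrite mp_fact_strip; last exact: blk3_inj.
rewrite big_mkcond -(pair_bigA _ (fun a' v => if blk3 (a', v) != mset0 then
  (count_mem (a', v) [seq p <- L | p.1 == a])`! else 1%N)) /=.
rewrite (bigD1 a) //= [X in (_ * X)%N]big1 ?muln1 => [|a' a'a].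
  rewrite [RHS]big_mkcond; apply: eq_bigr => v _; rewrite blk3_eq0 /=; case: ifP => // _.
  congr (_`!); rewrite count_filter; apply: eq_count => p /=.
  by case: eqP => //= ->; rewrite eqxx.
apply: big1 => v _; case: ifP => // _; rewrite count_filter.
rewrite (@eq_count _ _ pred0) ?count_pred0 // => p /=.
by case: eqP => //= ->; rewrite (negbTE a'a).
Qed.
End Fibre.

(** By [sum_zip_perm] the number of [g] is a product of multinomial coefficients over the outer
    pairs [a]. A nonzero [a] gives a factor of [a_nu]; the zero pair gives [b_nu(n)]. *)
Lemma horner_mp_coef_count n (f h : n.-tuple V) nu (L : seq ((V * V) * V)) :
  size L = n -> strip (map (@blk3 k r) L) = nu ->
  pair_type f h = mp_relabel (@unbar2 k) (restr02 nu) ->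
  (mp_coef nu).[n%:R] = (\sum_(g : n.-tuple V) (triple_type f g h == nu))%:R.
Proof.
move=> sL nuL; rewrite -nuL restr02_blk3 unbar2_strip => /eqP.
have szq : size (zip f h) = n by rewrite size1_zip ?size_tuple.
(* Both lists have length [n], so equal types mean that the outer pairs of [L] are those of [(f, h)]
   up to order. *)
rewrite perm_strip ?size_map ?sL // => /(perm_map_inj (@blk01_inj k r)) qL.
have := sum_zip_perm szq (_ : perm_eq (unzip1 L) (zip f h)).
rewrite perm_sym => /(_ qL).
rewrite (eq_bigr (fun g : n.-tuple V => (triple_type f g h == nu) : nat)) => [|g _]; last first.
  rewrite -nuL perm_strip; last by rewrite !size_map sL size1_zip ?size_tuple.
  congr nat_of_bool; apply/idP/idP; first exact: perm_map.
  exact: (perm_map_inj (@blk3_inj k r)).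
rewrite (eq_bigr _ (fun a _ => congr1 factorial (permP qL (pred1 a)))).
rewrite nuL => count_triple_type.
set z := (zeroV k r, zeroV k r).
pose c a := count_mem a (unzip1 L); pose m a := (\prod_v (count_mem (a, v) L)`!)%N.
have m0 a : (m a)%:R != 0 :> C.
  by rewrite pnatr_eq0 -lt0n prodn_gt0 // => v; exact: fact_gt0.
have -> : (\sum_(g : n.-tuple V) (triple_type f g h == nu))%:R
    = \prod_a ((c a)`!%:R / (m a)%:R) :> C.
  rewrite prodf_div -!natr_prod; apply: (canRL (mulfK _)).
    by rewrite natr_prod prodf_seq_neq0; apply/allP => a _; rewrite m0.
  by rewrite -natrM /m (pair_bigA _ (fun a v => (count_mem (a, v) L)`!)) -count_triple_type;
    congr (_ * _)%:R; apply: eq_bigr => -[].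
(* Each of the [n] positions has either a nonempty outer block or the zero pair, so [c z] is the
   base of the falling factorial in [b_nu(n)]. *)
have size_restr02 : (size (restr02 nu) + c z)%N = n.
  rewrite -nuL restr02_blk3 size_strip count_map -sL -(size_map fst) addnC.
  rewrite -[RHS](count_predC (pred1 z)); congr (_ + _)%N; apply: eq_count => a /=.
  by rewrite blk02_eq0.
rewrite horner_mp_coef; last by rewrite -size_restr02 leq_addr.
rewrite -{1}size_restr02 addKn -nuL restr02_blk3 mp_middle_blk3.
(* Outer pairs that do not occur in [L] have an empty fibre and contribute [0!] divided by 1. *)
rewrite (big_strip (@blk02_inj k r)) => [|a aL]; last first.
  have L0 : [seq p <- L | p.1 == a] = [::].
    apply/eqP; rewrite -[_ == _]negbK -has_filter; apply: contra aL => /hasP[p pL /eqP<-].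
    exact: map_f.
  rewrite mp_above_blk3 mp_fact_fibre size_strip L0 /= fact0 big1 ?divr1 // => v _.
  rewrite (count_memPn _) //; apply: contra aL => /(map_f fst); exact.
rewrite [RHS](bigD1 z) //= mulrC; congr (_ * _).
  rewrite size_fibre mp_fact_fibre /m [in RHS](bigD1 (zeroV k r)) //=.
  rewrite [X in (_ / X%:R = _)](eq_bigl (fun v => v != zeroV k r)); last first.
    by move=> v; rewrite /z xpair_eqE eqxx.
  set s := count _ L; set P := (\prod_(v | _) _)%N.
  (* Of the [c z] positions with zero outer pair, [s] carry a block of [beta] and the others an
     empty block. The factorial for the empty ones cancels, which leaves a falling factorial. *)
  have cE : (c z = s + count_mem (z, zeroV k r) L)%N.
    rewrite /c count_map /s; elim: (L) => //= p L' ->; rewrite addnACA; congr (_ + _)%N.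
    by case: (p =P (z, zeroV k r)) => [->|_]; rewrite ?eqxx ?andbF ?andbT ?addn0.
  rewrite -(ffact_fact (_ : s <= c z)%N); last by rewrite cE leq_addr.
  rewrite {3}cE addKn !natrM invfM mulrACA mulrA divfK //.
  by rewrite pnatr_eq0 -lt0n fact_gt0.
(* Over a nonzero pair no block is empty, so the fibre has [c a] blocks. *)
apply: eq_big => a; first by rewrite blk02_eq0.
rewrite blk02_eq0 => az; rewrite mp_above_blk3 size_fibre mp_fact_fibre.
have nz v : (a, v) != (zeroV k r, zeroV k r, zeroV k r) by rewrite xpair_eqE negb_and az.
congr (_`!%:R / _%:R); last by apply: eq_bigl => v; rewrite nz.
by rewrite /c count_map; apply: eq_count => -[a' v] /=; case: eqP => //= ->; rewrite nz.
Qed.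
End Poly.

(** * Associativity of the structure constants *)

Section Constants.
Variables (R : realType) (k r : nat).
Local Notation C := R[i].
Local Notation V := {ffun 'I_k -> 'I_r.+1}.

(** The coefficient of [X_mu] in the product of [X_pi] and [X_gamma], kept as a polynomial for
    evaluation. *)
Definition struct_poly (pi gamma mu : Pi r k) : {poly C} :=
  \sum_(nu : Gamma r k | [&& restr01 nu == mpart_val pi,
      restr12 nu == mp_relabel (@add_bar k) gamma & outer nu == mu])
    mp_coef R nu.

Lemma mp_mulXE pi gamma mu :
  mp_mulX R pi gamma mu = tofrac (struct_poly pi gamma mu).
Proof.
rewrite /mp_mulX sum_ffunE rmorph_sum /= big_mkcond [RHS]big_mkcond /=.
apply: eq_bigr => nu _; rewrite andbA; case: (_ && (_ == mp_relabel _ _)) => //=.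
rewrite !ffunE eq_sym tofrac_mp_coef; case: eqP => _; last exact: mulr0.
exact: mulr1.
Qed.

(** Each [nu] contributes the number of [g] for which [(f, g, h)] has type [nu]. After exchanging
    the sums, every admissible [g] is counted exactly once, at its own triple type. *)
Lemma horner_struct_poly n (f h : n.-tuple V) pi gamma mu :
  (forall nu : Gamma r k, size (mpart_val nu) <= n)%N -> pair_type f h = mpart_val mu ->
  (struct_poly pi gamma mu).[n%:R] =
    (\sum_(g : n.-tuple V | (pair_type f g == mpart_val pi) &&
                             (pair_type g h == mpart_val gamma)) 1)%:R.
Proof.
move=> nuP fh; rewrite horner_sum.
pose P (nu : Gamma r k) := [&& restr01 nu == mpart_val pi,
      restr12 nu == mp_relabel (@add_bar k) gamma & outer nu == mu].
transitivity ((\sum_(nu : Gamma r k | P nu)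
                 \sum_(g : n.-tuple V) (triple_type f g h == mpart_val nu))%:R : C).
  rewrite natr_sum; apply: eq_bigr => nu /and3P[_ _ /eqP nu_mu].
  have [L sL LE] := Gamma_code (nuP nu).
  by apply: (horner_mp_coef_count R sL LE); rewrite fh -nu_mu.
congr (_%:R); rewrite exchange_big [RHS]big_mkcond /=; apply: eq_bigr => g _.
have gf : size g = size f by rewrite !size_tuple.
have hf : size h = size f by rewrite !size_tuple.
(* The condition on [nu] involves only its restrictions, which are the types of the pairs of words;
   [gamma] is recovered because adding a bar is injective. *)
have restrE (nu : Gamma r k) : triple_type f g h = mpart_val nu ->
    P nu = (pair_type f g == mpart_val pi) && (pair_type g h == mpart_val gamma).
  move=> nuE; rewrite /P -nuE restr01_triple_type // restr12_triple_type //.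
  rewrite (inj_eq (mset_map_inj (mset_map_inj (@add_bar_inj k)))).
  have -> : outer nu == mu; last by rewrite andbT.
  apply/eqP/val_inj; rewrite /= -nuE restr02_blk3 unbar2_strip unzip1_zip //.
  by rewrite size1_zip ?hf ?gf.
case: ifP => [/andP[/eqP fg /eqP gh]|nfgh]; last first.
  apply: big1 => nu Pnu; apply/eqP; rewrite eqb0; apply/negP => /eqP/restrE.
  by rewrite Pnu nfgh.
(* All three words have total [r], so the triple type is an element of [Gamma r k]. *)
have : is_mpart 2 r (pair_type f g) by rewrite fg; apply: mpartP.
rewrite is_mpart_pair_type // => /andP[/eqP tf /eqP tg].
have : is_mpart 2 r (pair_type f h) by rewrite fh; apply: mpartP.
rewrite is_mpart_pair_type // => /andP[_ /eqP th].
pose nu := MPart (is_mpart_triple_type gf hf tf tg th).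
rewrite (bigD1 nu) /=; last by rewrite restrE // fg gh !eqxx.
rewrite eqxx big1 ?addn0 // => nu' /andP[_ nu'nu]; apply/eqP; rewrite eqb0.
by rewrite eq_sym; apply: contra nu'nu => /eqP E; apply/eqP/val_inj.
Qed.

(** The difference has as many roots as its size, hence more than its degree allows; they are
    distinct because the characteristic is zero. *)
Lemma poly_natP (p q : {poly C}) n0 :
  (forall n, (n0 <= n)%N -> p.[n%:R] = q.[n%:R]) -> p = q.
Proof.
move=> pq; apply/eqP; rewrite -subr_eq0; apply/eqP.
apply: (@roots_geq_poly_eq0 _ _ [seq i%:R | i <- iota n0 (size (p - q))]).
- apply/allP => _ /mapP[n + ->]; rewrite mem_iota => /andP[n0n _].
  by rewrite /root hornerD hornerN pq // subrr.
- by rewrite map_inj_uniq ?iota_uniq //; apply: mulrIn; rewrite oner_eq0.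
- by rewrite size_map size_iota.
Qed.

Lemma struct_poly_assoc pi gamma delta mu :
  \sum_eta struct_poly gamma delta eta * struct_poly pi eta mu =
  \sum_eta struct_poly pi gamma eta * struct_poly eta delta mu.
Proof.
(* Large enough to bound the number of blocks of [mu] and of every [nu] in the finite type
   [Gamma r k]. *)
pose n0 := (\sum_(nu : Gamma r k) size (mpart_val nu) + size (mpart_val mu))%N.
apply: (@poly_natP _ _ n0) => n n0n.
have nuP (nu : Gamma r k) : (size (mpart_val nu) <= n)%N.
  by apply: leq_trans n0n; rewrite /n0 (bigD1 nu) //= -addnA leq_addr.
have [|f [h fh]] := @Pi_words k r n mu.
  by apply: leq_trans n0n; rewrite /n0 leq_addl.
have total_of_type (f' g' : n.-tuple V) (p : Pi r k) : pair_type f' g' = mpart_val p ->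
    (total f' == r) && (total g' == r).
  by move=> E; rewrite -is_mpart_pair_type ?size_tuple // E; apply: mpartP.
have /andP[tf th] := total_of_type _ _ _ fh.
(* A pair of words of total [r] has exactly one type, so the sum over intermediate types collapses
   to one term. *)
have key (f' h' : n.-tuple V) (F : Pi r k -> C) :
  total f' == r -> total h' == r -> 
  exists2 eta : Pi r k, pair_type f' h' = mpart_val eta &
     \sum_eta' (pair_type f' h' == mpart_val eta')%:R * F eta' = F eta.
  move=> tf' th'.
  have P : is_mpart 2 r (pair_type f' h') by rewrite is_mpart_pair_type ?size_tuple // tf' th'.
  exists (MPart P) => //; rewrite (bigD1 (MPart P)) //= eqxx mul1r big1 ?addr0 // => e ne.
  rewrite (_ : _ == _ = false) ?mul0r //; apply: contra_neqF ne => /eqP E.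
  exact: val_inj.
(* Both sides count the pairs [(g, g')] whose consecutive pairs in the chain
   [f, g, g', h] have types [pi], [gamma], [delta]. *)
transitivity (\sum_(g : n.-tuple V) \sum_(g' : n.-tuple V)
   [&& pair_type f g == mpart_val pi, pair_type g g' == mpart_val gamma
     & pair_type g' h == mpart_val delta]%:R : C).
  rewrite horner_sum.
  transitivity (\sum_(g : n.-tuple V | pair_type f g == mpart_val pi)
     \sum_eta (pair_type g h == mpart_val eta)%:R * (struct_poly gamma delta eta).[n%:R]).
    rewrite exchange_big /=; apply: eq_bigr => eta _.
    rewrite hornerM (horner_struct_poly _ _ nuP fh) mulrC natr_sum -big_distrl /=.
    congr (_ * _); rewrite big_mkcondr /=; apply: eq_bigr => g _; by case: ifP.
  rewrite big_mkcond /=; apply: eq_bigr => g _; case: eqP => [fg|_]; last first.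
    by rewrite big1.
  have /andP[_ tg] := total_of_type _ _ _ fg.
  have [eta gh ->] := key g h (fun e => (struct_poly gamma delta e).[n%:R]) tg th.
  rewrite (horner_struct_poly _ _ nuP gh) natr_sum big_mkcond /=.
  by apply: eq_bigr => g' _; case: ifP.
(* For the other bracketing the word next to [h] is fixed first, and the intermediate type is that
   of its pair with [f]. *)
rewrite exchange_big horner_sum /=.
transitivity (\sum_(g : n.-tuple V | pair_type g h == mpart_val delta)
     \sum_eta (pair_type f g == mpart_val eta)%:R * (struct_poly pi gamma eta).[n%:R]).
  rewrite [RHS]big_mkcond /=; apply: eq_bigr => g _; case: eqP => [gh|_]; last first.
    by rewrite big1 // => g' _; rewrite !andbF.
  have /andP[tg _] := total_of_type _ _ _ gh.
  have [eta fg ->] := key f g (fun e => (struct_poly pi gamma e).[n%:R]) tf tg.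
  rewrite (horner_struct_poly _ _ nuP fg) natr_sum [RHS]big_mkcond /=.
  by apply: eq_bigr => g' _; rewrite andbT; case: ifP.
rewrite exchange_big /=; apply: eq_bigr => eta _.
rewrite hornerM (horner_struct_poly _ _ nuP fh) [RHS]mulrC natr_sum -big_distrl /=.
congr (_ * _); under [in RHS]eq_bigl do rewrite andbC.
by rewrite [RHS]big_mkcondr /=; apply: eq_bigr => g _; case: ifP.
Qed.

Lemma mp_mulE (u v : MP R r k) mu : mp_mul u v mu =
  \sum_pi \sum_gamma u pi * v gamma * tofrac (struct_poly pi gamma mu).
Proof.
rewrite /mp_mul sum_ffunE; apply: eq_bigr => pi _; rewrite sum_ffunE.
by apply: eq_bigr => gamma _; rewrite ffunE mp_mulXE.
Qed.
End Constants.

(** * From basis elements to arbitrary vectors *)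

(** Both sides expand into the same triple sum over [p], [g], [d], with the sum over the
    intermediate index [e] innermost, where the hypothesis applies. *)
Lemma struct_const_assoc (F : comNzRingType) (I : finType) (s : I -> I -> I -> F)
    (u v w : I -> F) m :
  (forall p g d, \sum_e s g d e * s p e m = \sum_e s p g e * s e d m) ->
  \sum_p \sum_e u p * (\sum_g \sum_d v g * w d * s g d e) * s p e m =
  \sum_e \sum_d (\sum_p \sum_g u p * v g * s p g e) * w d * s e d m.
Proof.
move=> sA.
transitivity (\sum_p \sum_g \sum_d u p * v g * w d * (\sum_e s g d e * s p e m)).
  apply: eq_bigr => p _.
  under eq_bigr do rewrite -mulrA mulr_suml mulr_sumr.
  rewrite exchange_big /=; apply: eq_bigr => g _.
  under eq_bigr do rewrite mulr_suml mulr_sumr.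
  rewrite exchange_big /=; apply: eq_bigr => d _.
  by rewrite mulr_sumr; apply: eq_bigr => e _; rewrite !mulrA.
transitivity (\sum_p \sum_g \sum_d u p * v g * w d * (\sum_e s p g e * s e d m)).
  by do 3 (apply: eq_bigr => ? _); rewrite sA.
under eq_bigr do rewrite exchange_big /=.
rewrite exchange_big /= [RHS]exchange_big /=; apply: eq_bigr => d _.
under [RHS]eq_bigr do rewrite -mulrA mulr_suml.
rewrite [RHS]exchange_big /=; apply: eq_bigr => p _.
under [RHS]eq_bigr do rewrite mulr_suml.
rewrite [RHS]exchange_big /=; apply: eq_bigr => g _.
rewrite mulr_sumr; apply: eq_bigr => e _.
by rewrite -!mulrA; do 2 congr (_ * _); rewrite mulrCA.
Qed.

Theorem proposition3p4 (R : realType) (r k : nat) :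
  associative (@mp_mul R r k).
Proof.
move=> u v w; apply/ffunP => mu.
(* The polynomial identity is transported to rational functions, the scalars over which the product
   is bilinear. *)
pose s (p g m : Pi r k) : ratfun R := tofrac (struct_poly R p g m).
have assoc_s p g d :
    \sum_e s g d e * s p e mu = \sum_e s p g e * s e d mu.
  transitivity (tofrac (\sum_eta struct_poly R g d eta * struct_poly R p eta mu)).
    by rewrite rmorph_sum; apply: eq_bigr => e _; rewrite [RHS]tofracM.
  by rewrite struct_poly_assoc rmorph_sum; apply: eq_bigr => e _; exact: tofracM.
apply: etrans (etrans _ (struct_const_assoc u v w assoc_s)) _.
- apply: etrans (mp_mulE _ _ _) _.
  by apply: eq_bigr => p _; apply: eq_bigr => e _; rewrite -mp_mulE.
- apply: esym; apply: etrans (mp_mulE _ _ _) _.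
  by apply: eq_bigr => e _; apply: eq_bigr => d _; rewrite -mp_mulE.
Qed.
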